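(* Let $N\ge 1$ be an integer and let $\psi$ be a wavelet with $N$ vanishing moments. Then the Fourier-Like wavelet $\psi_F(t)=\frac{1}{\sqrt2}\left[\psi(t)-j\,\mathcal{H}\{\psi\}(t)\right]$, where $\mathcal{H}\{\psi\}$ is the Hilbert transform of $\psi$, also has $N$ vanishing moments.
   Context: The Fourier transform of $f\in L^2(\mathbb{R})$ (complex-valued functions allowed) is the $L^2$ Fourier transform with the convention $F(\omega)=\int_{-\infty}^{\infty} f(t)e^{-j\omega t}\,dt$, where $j=\sqrt{-1}$. A function $f$ is a (mother) wavelet if and only if (i) $f\in L^2(\mathbb{R})$ and (ii) $f$ satisfies the admissibility condition $\int_{-\infty}^{\infty}\frac{|F(\omega)|^2}{|\omega|}\,d\omega<+\infty$. The Hilbert transform of $f$ is $\mathcal{H}\{f\}(t)=\mathrm{p.v.}\,\frac{1}{\pi}\int_{-\infty}^{\infty}\frac{f(\tau)}{t-\tau}\,d\tau$; equivalently, the Fourier transform of $\mathcal{H}\{f\}$ is $-j\,\mathrm{sgn}(\omega)F(\omega)$, where $\mathrm{sgn}(\omega)=1,0,-1$ for $\omega>0$, $\omega=0$, $\omega<0$ respectively. The $n$th moment of $f$ is $M_n[f]=\int_{-\infty}^{\infty}t^n f(t)\,dt$, expressed in the frequency domain, up to a nonzero constant factor depending only on $n$, as $F^{(n)}(0)$ (the $n$th derivative of $F$ at $0$). A function $f$ has $N$ vanishing moments if $M_n[f]=0$ for $n=0,1,\ldots,N-1$. Moments are understood through their frequency-domain expression: $f$ has $N$ vanishing moments means that $F$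 agrees almost everywhere with a function that is $N-1$ times continuously differentiable in a neighborhood of $0$ and satisfies $F^{(n)}(0)=0$ for $n=0,1,\ldots,N-1$. *)

(* Defs.v *)
From mathcomp Require Import all_boot all_order all_algebra.
From mathcomp Require Import all_classical all_reals all_analysis.
From mathcomp Require Export complex.
Import Order.TTheory GRing.Theory Num.Theory.
Import numFieldNormedType.Exports.

Set Implicit Arguments.
Unset Strict Implicit.
Unset Printing Implicit Defensive.

Local Open Scope classical_set_scope.
Local Open Scope ring_scope.
Local Open Scope complex_scope.

(** Complex-valued functions on the line have type [R -> R[i]], where
    [R : realType].  The library has neither a measurable structure on [R[i]]
    nor derivatives of functions [R -> R[i]], so measurability, integrals and
    derivatives are taken on the real and imaginary parts. *)

Section FourierLikeWavelet.
Context {R : realType}.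
Implicit Types (f h F G : R -> R[i]) (g : R -> R).

Local Notation mu := (@lebesgue_measure R).

Definition sqmod (z : R[i]) : R := Normc.normc z ^+ 2.

Definition in_L2 f : Prop :=
  [/\ measurable_fun setT (fun t => complex.Re (f t)),
      measurable_fun setT (fun t => complex.Im (f t)) &
      (\int[mu]_t (sqmod (f t))%:E < +oo)%E].

Definition Cintegral (D : set R) f : R[i] :=
  (Rintegral mu D (fun t => complex.Re (f t))) +i*
  (Rintegral mu D (fun t => complex.Im (f t))).

(** [expiN x] is e^{-jx}. *)
Definition expiN (x : R) : R[i] := cos x -i* sin x.

Definition truncated_fourier (A : R) f (w : R) : R[i] :=
  Cintegral `[- A, A] (fun t => f t * expiN (w * t)).

(** [is_fourier f F]: [F] is (a version of) the L^2 Fourier transform of [f],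
    that is, the limit in L^2(dw) of [\int_(-A)^A f(t) e^{-jwt} dt] as [A]
    tends to infinity.  It is a relation because F is only determined up to
    equality almost everywhere. *)
Definition is_fourier f F : Prop :=
  [/\ in_L2 f, in_L2 F &
      (\int[mu]_w (sqmod (F w - truncated_fourier A f w))%:E)%E
        @[A --> +oo] --> 0%E].

(** The convention [0^-1 = 0] makes the integrand 0 at [w = 0], a null set. *)
Definition is_wavelet f : Prop :=
  in_L2 f /\
  exists F, is_fourier f F /\ (\int[mu]_w (sqmod (F w) / `|w|)%:E < +oo)%E.

(** [is_hilbert f h]: [h] is (a version of) the Hilbert transform of the L^2
    function [f], given by the Fourier multiplier [-j sgn w]. *)
Definition is_hilbert f h : Prop :=
  exists F, is_fourier f F /\
    is_fourier h (fun w => - 'i%C * (Num.sg w)%:C * F w).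

(** [g] is [k] times continuously differentiable in a neighbourhood of [x0]. *)
Definition Ck_near (k : nat) (x0 : R) g : Prop :=
  \forall x \near x0,
    (forall n, (n < k)%N -> derivable (derive1n n g) x 1) /\
    {for x, continuous (derive1n k g)}.

(** Vanishing of the first [N] moments (for [N >= 1]), the [n]th moment being
    read as the [n]th derivative at 0 of the Fourier transform. *)
Definition vanishing_moments (N : nat) f : Prop :=
  exists F G,
    [/\ is_fourier f F,
        {ae mu, forall w, F w = G w},
        Ck_near N.-1 0 (fun w => complex.Re (G w)),
        Ck_near N.-1 0 (fun w => complex.Im (G w)) &
        forall n, (n < N)%N ->
          derive1n n (fun w => complex.Re (G w)) 0 = 0 /\
          derive1n n (fun w => complex.Im (G w)) 0 = 0].

(** [h] is meant to be the Hilbert transform of [f]. *)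
Definition fourier_like f h : R -> R[i] :=
  fun t => ((Num.sqrt 2)^-1)%:C * (f t - 'i%C * h t).

End FourierLikeWavelet.

(* Main.v *)
Require Import Defs.
From mathcomp Require Import all_boot all_order all_algebra.
From mathcomp Require Import all_classical all_reals all_analysis.
From mathcomp Require Import measurable_realfun ring lra.
Import Order.TTheory GRing.Theory Num.Theory.
Import numFieldNormedType.Exports.

(** Why the theorem is true.

    On the Fourier side, passing from psi to its Fourier-like wavelet
    multiplies the spectrum F by a step function: since the Hilbert transform
    has spectrum [-j sgn(w) F(w)], linearity gives
      [(1/sqrt 2) (F - j (-j sgn) F) = s F],  [s(w) = (1 - sgn w) / sqrt 2].
    The spectrum is erased for w > 0 and multiplied by [sqrt 2] for w < 0.
    The step function s is bounded and locally constant away from 0, so the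
    only question is what happens at 0.  There, the vanishing moments say that
    the derivatives of orders 0, ..., N - 1 of F are all zero, and a function
    which is zero together with its derivative at 0 remains so after
    multiplication by any bounded function: the difference quotient is
    multiplied by a bounded factor and still tends to 0.  By induction on the
    order, [(s F)^(n) = s F^(n)] near 0 for all n < N
    ([step_is_derive], [step_derive1n]), so that s F is again N - 1 times
    continuously differentiable and flat at 0 ([step_Ck_near_flat]).

    The L^2 Fourier transform is a relation between a function and any version
    of its transform, so two facts about it are needed: linearity
    ([is_fourier_lin]), and uniqueness up to null sets ([is_fourier_unique]),
    because the version witnessing the vanishing moments and the one
    witnessing the Hilbert transform may differ.  Uniqueness is linearity
    applied to the difference of two versions, which is a transform of 0.
    Linearity itself is the estimate |x + y|^2 <= 2 |x|^2 + 2 |y|^2,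
    integrated; as the Lebesgue integral is subadditive on measurable
    functions only, it has to be shown that the truncated transform is a
    measurable function of the frequency ([truncated_fourier_measurable]),
    which follows from its continuity, by dominated convergence. *)

Set Implicit Arguments.
Unset Strict Implicit.
Unset Printing Implicit Defensive.

Local Open Scope classical_set_scope.
Local Open Scope ring_scope.
Local Open Scope complex_scope.

(** * Real and imaginary parts, and the squared modulus *)

Section ComplexParts.
Context {R : realType}.
Implicit Types x y a b u v : R[i].

Lemma Re_add x y : complex.Re (x + y) = complex.Re x + complex.Re y.
Proof. by case: x; case: y. Qed.

Lemma Im_add x y : complex.Im (x + y) = complex.Im x + complex.Im y.
Proof. by case: x; case: y. Qed.

Lemma Re_mul x y : complex.Re (x * y) =
  complex.Re x * complex.Re y - complex.Im x * complex.Im y.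
Proof. by case: x; case: y. Qed.

Lemma Im_mul x y : complex.Im (x * y) =
  complex.Re x * complex.Im y + complex.Im x * complex.Re y.
Proof. by case: x; case: y. Qed.

Lemma sqmodE x : sqmod x = complex.Re x ^+ 2 + complex.Im x ^+ 2.
Proof. by case: x => p q; rewrite /sqmod /= sqr_sqrtr// addr_ge0// sqr_ge0. Qed.

Lemma sqmod_ge0 x : 0 <= sqmod x.
Proof. by rewrite /sqmod sqr_ge0. Qed.

Lemma sqmod_eq0 x : sqmod x = 0 -> x = 0.
Proof. by move=> /eqP; rewrite sqrf_eq0 => /eqP/Normc.eq0_normc. Qed.

(** The convexity bound |x + y|^2 <= 2 |x|^2 + 2 |y|^2, with the coefficients
    taken out; it stands in for the triangle inequality of the L^2 norm. *)
Lemma sqmod_lin a b u v :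
  sqmod (a * u + b * v) <= 2 * sqmod a * sqmod u + 2 * sqmod b * sqmod v.
Proof.
have sqM x y : sqmod (x * y) = sqmod x * sqmod y.
  by rewrite /sqmod Normc.normcM exprMn.
rewrite -!(mulrA 2) -!sqM !sqmodE !Re_add !Im_add.
set p := complex.Re (a * u); set q := complex.Re (b * v).
set r := complex.Im (a * u); set s := complex.Im (b * v).
have := sqr_ge0 (p - q); have := sqr_ge0 (r - s); nra.
Qed.

End ComplexParts.

(** * Measurability and integrability of complex-valued functions *)

Section FourierTransform.
Context {R : realType}.
Local Notation mu := (@lebesgue_measure R).
(* The Borel sigma-algebra of R comes under two displays; [lebesgue_measure]
   is defined on this one. *)
Local Notation line := (measurableTypeR R).
Implicit Types (f g F G : line -> R[i]) (D : set line).

Definition Cmeasurable D f :=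
  measurable_fun D (fun t => complex.Re (f t)) /\
  measurable_fun D (fun t => complex.Im (f t)).

Definition Cintegrable D f :=
  mu.-integrable D (EFin \o (fun t => complex.Re (f t))) /\
  mu.-integrable D (EFin \o (fun t => complex.Im (f t))).

Lemma CmeasurableD D f g :
  Cmeasurable D f -> Cmeasurable D g -> Cmeasurable D (fun t => f t + g t).
Proof.
move=> [f1 f2] [g1 g2]; split.
- by under eq_fun do rewrite Re_add; exact: measurable_funD.
- by under eq_fun do rewrite Im_add; exact: measurable_funD.
Qed.

Lemma CmeasurableM D f g :
  Cmeasurable D f -> Cmeasurable D g -> Cmeasurable D (fun t => f t * g t).
Proof.
move=> [f1 f2] [g1 g2]; split.
- under eq_fun do rewrite Re_mul.
  by apply: measurable_funB; exact: measurable_funM.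
- under eq_fun do rewrite Im_mul.
  by apply: measurable_funD; exact: measurable_funM.
Qed.

Lemma Cmeasurable_cst D (a : R[i]) : Cmeasurable D (fun=> a).
Proof. by split; exact: measurable_cst. Qed.

Lemma measurable_sqmod f : Cmeasurable setT f ->
  measurable_fun setT (fun t => (sqmod (f t))%:E).
Proof.
move=> [f1 f2]; apply/measurable_EFinP; under eq_fun do rewrite sqmodE.
by apply: measurable_funD; exact: measurable_funX.
Qed.

Lemma in_L2_measurable f : in_L2 f -> Cmeasurable setT f.
Proof. by case. Qed.

Lemma Cmeasurable_lin D a b f g : Cmeasurable D f -> Cmeasurable D g ->
  Cmeasurable D (fun t => a * f t + b * g t).
Proof.
by move=> mf mg; apply: CmeasurableD; apply: CmeasurableM => //;
  exact: Cmeasurable_cst.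
Qed.

Lemma integral_sqmod_lin a b f g : Cmeasurable setT f -> Cmeasurable setT g ->
  (\int[mu]_t (sqmod (a * f t + b * g t))%:E <=
   (2 * sqmod a)%:E * \int[mu]_t (sqmod (f t))%:E +
   (2 * sqmod b)%:E * \int[mu]_t (sqmod (g t))%:E)%E.
Proof.
move=> mf mg.
have s0 (c : R[i]) : 0 <= 2 * sqmod c by rewrite mulr_ge0 ?sqmod_ge0.
have mZ (c : R) h : Cmeasurable setT h ->
    measurable_fun setT (fun t => c%:E * (sqmod (h t))%:E)%E.
  by move=> mh; apply: measurable_funeM; exact: measurable_sqmod.
rewrite -!ge0_integralZl ?lee_fin//=; try exact: measurable_sqmod;
  try by move=> *; rewrite lee_fin sqmod_ge0.
rewrite -ge0_integralD//=; try exact: mZ;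
  try by move=> *; rewrite -EFinM lee_fin mulr_ge0// sqmod_ge0.
apply: ge0_le_integral => //=.
- by move=> *; rewrite lee_fin sqmod_ge0.
- apply: measurable_sqmod; exact: Cmeasurable_lin.
- by apply: emeasurable_funD; exact: mZ.
- by move=> t _; rewrite -!EFinM -EFinD lee_fin sqmod_lin.
Qed.

Lemma in_L2_lin a b f g : in_L2 f -> in_L2 g ->
  in_L2 (fun t => a * f t + b * g t).
Proof.
move=> Lf Lg; have mf := in_L2_measurable Lf; have mg := in_L2_measurable Lg.
have [m1 m2] := Cmeasurable_lin a b mf mg; split => //.
apply: le_lt_trans (integral_sqmod_lin a b mf mg) _.
case: Lf Lg => _ _ If [_ _ Ig].
have s0 (c : R[i]) : 0 <= 2 * sqmod c by rewrite mulr_ge0 ?sqmod_ge0.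
by rewrite lte_add_pinfty// lte_mul_pinfty// lee_fin.
Qed.

(** Because |x| <= 1 + |x|^2, and the interval has finite measure. *)
Lemma in_L2_integrable A f : in_L2 f -> Cintegrable `[- A, A] f.
Proof.
move=> Lf; have [m1 m2 If] := Lf; have mf := in_L2_measurable Lf.
have mD : measurable (`[- A, A] : set line) by [].
have muD : (mu `[(- A)%R, A]%classic < +oo)%E.
  by rewrite lebesgue_measure_itv/=; case: ifP => _; rewrite ?ltry// -EFinD ltry.
have I1 : mu.-integrable `[- A, A] (EFin \o (fun=> 1 : R)).
  apply: measurable_bounded_integrable => //; exact: bounded_cst.
have I2 : mu.-integrable `[- A, A] (EFin \o (fun t => sqmod (f t))).
  apply: (@integrableS _ _ _ _ setT) => //; apply/integrableP; split.
    exact: measurable_sqmod.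
  by under eq_integral do rewrite /= ger0_norm ?sqmod_ge0//.
have I3 : mu.-integrable `[- A, A] (EFin \o (fun t => 1 + sqmod (f t))).
  by apply: integrableD I1 I2.
have le1 (x y : R) : `|x| <= `|1 + (x ^+ 2 + y ^+ 2)|.
  rewrite [X in _ <= X]ger0_norm; last by rewrite !addr_ge0 ?sqr_ge0.
  have := sqr_ge0 (`|x| - 1); have := sqr_ge0 y; have := sqr_ge0 x.
  by rewrite -(real_normK (num_real x)); nra.
split; apply: (le_integrable _ _ _ I3) => //=.
- by apply/measurable_EFinP; exact: measurable_funTS.
- by move=> t _; rewrite lee_fin sqmodE; exact: le1.
- by apply/measurable_EFinP; exact: measurable_funTS.
- by move=> t _; rewrite lee_fin sqmodE (addrC (_ ^+ 2)); exact: le1.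
Qed.

Lemma CintegralD D f g : measurable D -> Cintegrable D f -> Cintegrable D g ->
  Cintegral D (fun t => f t + g t) = Cintegral D f + Cintegral D g.
Proof.
move=> mD [f1 f2] [g1 g2]; rewrite /Cintegral.
under eq_Rintegral do rewrite Re_add.
under [X in _ +i* X]eq_Rintegral do rewrite Im_add.
by rewrite !RintegralD.
Qed.

Lemma CintegrableZ D a f : measurable D -> Cintegrable D f ->
  Cintegrable D (fun t => a * f t).
Proof.
move=> mD [f1 f2].
have Z c h : mu.-integrable D (EFin \o h) ->
  mu.-integrable D (EFin \o (fun t => c * h t)).
  by move=> ih; exact: (integrableZl mD c ih).
split.
- apply: eq_integrable
    (integrableB mD (Z (complex.Re a) _ f1) (Z (complex.Im a) _ f2)) => //.
  by move=> t _ /=; rewrite Re_mul.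
- apply: eq_integrable
    (integrableD mD (Z (complex.Re a) _ f2) (Z (complex.Im a) _ f1)) => //.
  by move=> t _ /=; rewrite Im_mul.
Qed.

Lemma CintegralZ D a f : measurable D -> Cintegrable D f ->
  Cintegral D (fun t => a * f t) = a * Cintegral D f.
Proof.
move=> mD [f1 f2]; rewrite /Cintegral.
have Z c h : mu.-integrable D (EFin \o h) ->
  mu.-integrable D (EFin \o (fun t => c * h t)).
  by move=> ih; exact: (integrableZl mD c ih).
under eq_Rintegral do rewrite Re_mul.
under [X in _ +i* X]eq_Rintegral do rewrite Im_mul.
rewrite RintegralB ?RintegralD; try exact: Z; try by [].
by rewrite !RintegralZl//; case: a.
Qed.

(** * Truncated Fourier transforms *)

Section BoundedKernel.
Variables (D : set line) (a : line -> R) (phi : R -> R).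
Hypotheses (mD : measurable D) (ia : mu.-integrable D (EFin \o a)).
Hypotheses (cphi : continuous phi) (phi1 : forall x, `|phi x| <= 1).

Lemma kernel_le w t : `|a t * phi (w * t)| <= `|a t|.
Proof. by rewrite normrM ler_piMr. Qed.

Lemma kernel_integrable w :
  mu.-integrable D (EFin \o (fun t => a t * phi (w * t))).
Proof.
apply: (le_integrable mD _ _ ia) => /=; last first.
  by move=> t _; rewrite lee_fin kernel_le.
have ma : measurable_fun D a by apply/measurable_EFinP; case/integrableP : ia.
have mphi : measurable_fun setT (phi : line -> R).
  exact: continuous_measurable_fun.
apply/measurable_EFinP; apply: measurable_funM => //.
apply: (measurableT_comp mphi).
by apply: measurable_funM => //; exact: measurable_id.
Qed.

(** Dominated convergence, with the bound |a| independent of the frequency.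
    The kernels of interest are phi = cos and phi = sin. *)
Lemma kernel_integral_continuous :
  continuous (fun w : R => Rintegral mu D (fun t => a t * phi (w * t))).
Proof.
move=> w.
have w1 : w \in (`]w - 1, w + 1[%classic : set R).
  by rewrite inE /= in_itv /= ltrBlDr ltrDl ltr01.
(* Continuity under the integral sign is a statement on a bounded open interval
   of parameters; any one around w will do. *)
apply: (@continuity_under_integral _ _ _ mu
  (fun w t => a t * phi (w * t)) D mD (w - 1) (w + 1) _ _ (Num.norm \o a)) => //.
- by move=> x _; exact: kernel_integrable.
- apply: aeW => t _ x _; apply: cvgM; first exact: cvg_cst.
  apply: continuous_comp; last exact: cphi.
  by apply: cvgM; [exact: cvg_id|exact: cvg_cst].
- exact: integrable_norm.
- by move=> x _; apply: aeW => t _; exact: kernel_le.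
Qed.

Lemma kernel_integral_measurable : measurable_fun setT
  (fun w : line => Rintegral mu D (fun t => a t * phi (w * t))).
Proof. exact: continuous_measurable_fun kernel_integral_continuous. Qed.

End BoundedKernel.

Lemma Re_expiN f w t : complex.Re (f t * expiN (w * t)) =
  complex.Re (f t) * cos (w * t) + complex.Im (f t) * sin (w * t).
Proof. by rewrite Re_mul /= mulrN opprK. Qed.

Lemma Im_expiN f w t : complex.Im (f t * expiN (w * t)) =
  complex.Im (f t) * cos (w * t) - complex.Re (f t) * sin (w * t).
Proof. by rewrite Im_mul /= mulrN addrC. Qed.

Lemma Cintegrable_expiN D f w : measurable D -> Cintegrable D f ->
  Cintegrable D (fun t => f t * expiN (w * t)).
Proof.
move=> mD [f1 f2].
have kc h := fun ih => @kernel_integrable D h cos mD ih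
  (@continuous_cos R) (@cos_max R) w.
have ks h := fun ih => @kernel_integrable D h sin mD ih
  (@continuous_sin R) (@sin_max R) w.
split.
- apply: eq_integrable (integrableD mD (kc _ f1) (ks _ f2)) => //.
  by move=> t _ /=; rewrite Re_expiN.
- apply: eq_integrable (integrableB mD (kc _ f2) (ks _ f1)) => //.
  by move=> t _ /=; rewrite Im_expiN.
Qed.

(** Both parts of the truncated transform are combinations of cosine and sine
    integrals, each of which is continuous in the frequency. *)
Lemma truncated_fourier_measurable A f : in_L2 f ->
  Cmeasurable setT (truncated_fourier A f).
Proof.
move=> /(@in_L2_integrable A)[f1 f2].
have mD : measurable (`[- A, A] : set line) by [].
have ic h := fun ih => @kernel_integrable _ h cos mD ih
  (@continuous_cos R) (@cos_max R).
have is_ h := fun ih => @kernel_integrable _ h sin mD ih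
  (@continuous_sin R) (@sin_max R).
have kc h := fun ih => @kernel_integral_measurable _ h cos mD ih
  (@continuous_cos R) (@cos_max R).
have ks h := fun ih => @kernel_integral_measurable _ h sin mD ih
  (@continuous_sin R) (@sin_max R).
split; rewrite /truncated_fourier /Cintegral /=.
- under eq_fun => w.
    under eq_Rintegral do rewrite Re_expiN.
    rewrite RintegralD//; [|exact: ic|exact: is_].
    over.
  by apply: measurable_funD; [exact: kc|exact: ks].
- under eq_fun => w.
    under eq_Rintegral do rewrite Im_expiN.
    rewrite RintegralB//; [|exact: ic|exact: is_].
    over.
  by apply: measurable_funB; [exact: kc|exact: ks].
Qed.

Lemma truncated_fourier_lin A a b f g w : in_L2 f -> in_L2 g ->
  truncated_fourier A (fun t => a * f t + b * g t) w =
  a * truncated_fourier A f w + b * truncated_fourier A g w.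
Proof.
move=> Lf Lg; have mD : measurable (`[- A, A] : set line) by [].
have If := Cintegrable_expiN w mD (in_L2_integrable A Lf).
have Ig := Cintegrable_expiN w mD (in_L2_integrable A Lg).
rewrite /truncated_fourier -!CintegralZ// -CintegralD//;
  [|exact: CintegrableZ|exact: CintegrableZ].
by congr Cintegral; apply/funext => t; rewrite mulrDl !mulrA.
Qed.

(** * Linearity and uniqueness of the L^2 Fourier transform *)

(** The squared L^2 error of the combination is squeezed between 0 and a
    combination of the two squared errors ([integral_sqmod_lin]). *)
Lemma is_fourier_lin a b f g F G : is_fourier f F -> is_fourier g G ->
  is_fourier (fun t => a * f t + b * g t) (fun w => a * F w + b * G w).
Proof.
move=> [Lf LF cf] [Lg LG cg]; split; [exact: in_L2_lin|exact: in_L2_lin|].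
pose err A h H := (\int[mu]_w (sqmod (H w - truncated_fourier A h w))%:E)%E.
have merr A h H : in_L2 h -> in_L2 H ->
    Cmeasurable setT (fun w => H w - truncated_fourier A h w).
  move=> Lh LH.
  have := Cmeasurable_lin 1 (-1) (in_L2_measurable LH)
    (truncated_fourier_measurable A Lh).
  by under eq_fun do rewrite mul1r mulN1r.
have cvg0 : ((2 * sqmod a)%:E * err A f F + (2 * sqmod b)%:E * err A g G)%E
    @[A --> +oo] --> 0%E.
  have fin (c : R[i]) : (2 * sqmod c)%:E \is a fin_num by [].
  have ca := cvgeZl (fin a) cf; have cb := cvgeZl (fin b) cg.
  rewrite !mule0 in ca cb; have := cvgeD _ ca cb.
  by rewrite adde0; exact.
apply: squeeze_cvge (cvg_cst 0%E) cvg0; apply: nearW => A; apply/andP; split.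
  by apply: integral_ge0 => w _; rewrite lee_fin sqmod_ge0.
under eq_integral => w _.
  rewrite truncated_fourier_lin// opprD addrACA -!mulrBr.
  over.
by apply: integral_sqmod_lin; exact: merr.
Qed.

Lemma truncated_fourier0 A w : truncated_fourier A (fun=> 0 : R[i]) w = 0.
Proof.
rewrite /truncated_fourier /Cintegral.
under eq_Rintegral do rewrite mul0r.
under [X in _ +i* X]eq_Rintegral do rewrite mul0r.
by rewrite !Rintegral_cst// !mul0r.
Qed.

(** The difference F - F' is a transform of f - f = 0 by linearity.  The
    truncated transforms of 0 are 0, so the L^2 error is the constant
    |F - F'|^2 integrated over the line; being convergent to 0, it is 0. *)
Lemma is_fourier_unique f F F' : is_fourier f F -> is_fourier f F' ->
  {ae mu, forall w, F w = F' w}.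
Proof.
move=> fF fF'; have [Lf LF _] := fF; have [_ LF' _] := fF'.
have [_ LH cH] := is_fourier_lin 1 (-1) fF fF'.
have mH := in_L2_measurable LH.
have /(ae_eq_integral_abs mu measurableT (measurable_sqmod mH)) :
    (\int[mu]_w `|(sqmod (1 * F w + -1 * F' w))%:E| = 0)%E.
  move: cH; under eq_fun => A.
    under eq_integral => w _.
      rewrite (_ : (fun t => 1 * f t + _) = fun=> 0); last first.
        by apply/funext => t; rewrite mul1r mulN1r subrr.
      rewrite truncated_fourier0 subr0 -[sqmod _]ger0_norm ?sqmod_ge0//.
      over.
    over.
  by move/cvg_lim => <-//; rewrite lim_cst.
apply: filterS => w /(_ I) [/sqmod_eq0].
by rewrite mul1r mulN1r => /subr0_eq.
Qed.

End FourierTransform.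

(** * Multiplying a flat function by a step at the origin *)

Section StepMultiplier.
Context {R : realType}.
Variables (s : R -> R) (M : R).
Hypothesis s_loc : forall x, x != 0 -> \forall y \near x, s y = s x.
Hypothesis s_bnd : forall x, `|s x| <= M.
Implicit Types g : R -> R.

Lemma cvg0_mul_step (F : set_system R) {FF : Filter F} g :
  g x @[x --> F] --> 0 -> s x * g x @[x --> F] --> 0.
Proof.
move=> g0; apply/norm_cvg0P.
have : M * `|g x| @[x --> F] --> M * 0.
  by apply: cvgM; [exact: cvg_cst|exact/norm_cvg0P].
rewrite mulr0; apply: squeeze_cvgr; last exact: cvg_cst.
apply: nearW => x; rewrite normr_ge0 normrM ler_wpM2r//.
Qed.

Lemma step_continuous0 g : g 0 = 0 -> {for 0, continuous g} ->
  {for 0, continuous (fun x => s x * g x)}.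
Proof.
move=> g0 cg; rewrite /prop_for /continuous_at g0 mulr0.
by apply: cvg0_mul_step; rewrite -[X in _ --> X]g0.
Qed.

(** Off 0 the factor s is locally a constant.  At 0 the difference quotient of
    s g at h is s(h) times that of g, hence tends to 0; both hypotheses
    g(0) = 0 and g'(0) = 0 are what makes the jump of s harmless. *)
Lemma step_is_derive g x : derivable g x 1 ->
  (x = 0 -> g 0 = 0 /\ derive1 g 0 = 0) ->
  is_derive x 1 (fun y => s y * g y) (s x * derive1 g x).
Proof.
have [->{x}|x0] := eqVneq x 0 => dg; last first.
  move=> _; rewrite derive1E.
  apply: (@near_eq_is_derive _ _ _ (fun y => s x *: g y)).
    by near=> y; rewrite (near (s_loc x0) y).
  by apply: is_deriveZ; exact: derivableP.
move=> /(_ erefl)[g0 dg0].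
have Q0 : h^-1 *: (s (h *: 1 + 0) * g (h *: 1 + 0) - s 0 * g 0)
    @[h --> 0^'] --> 0.
  have -> : (fun h : R => h^-1 *: (s (h *: 1 + 0) * g (h *: 1 + 0) - s 0 * g 0))
      = (fun h => s h * (h^-1 *: (g (h *: 1 + 0) - g 0))).
    apply/funext => h; rewrite g0 mulr0 !subr0 addr0 /GRing.scale /= mulr1.
    by rewrite mulrCA.
  by apply: cvg0_mul_step; rewrite -[X in _ --> X]dg0 derive1E.
rewrite dg0 mulr0; apply: DeriveDef; first by apply/cvg_ex; exists 0.
exact: cvg_lim Q0.
Unshelve. all: by end_near. Qed.

(** Openness of U turns the induction hypothesis at the points of U into an
    equality near each of them, which may be differentiated. *)
Lemma step_derive1n g (k : nat) (U : set R) : open U ->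
  (forall x, U x -> forall n, (n < k)%N -> derivable (derive1n n g) x 1) ->
  (forall n, (n <= k)%N -> derive1n n g 0 = 0) ->
  forall n, (n <= k)%N -> forall x, U x ->
  derive1n n (fun y => s y * g y) x = s x * derive1n n g x.
Proof.
move=> oU dg g0; elim => [//|n IHn] nk x Ux.
rewrite !derive1nS derive1E.
have [] // := @step_is_derive (derive1n n g) x (dg _ Ux _ nk).
  by move=> _; rewrite -derive1nS !g0// ltnW.
move=> _ <-; apply: near_eq_derive.
by apply: filterS (open_nbhs_nbhs (conj oU Ux)) => y Uy; exact: IHn (ltnW nk) _ Uy.
Qed.

Lemma step_Ck_near_flat g k : Ck_near k 0 g ->
  (forall n, (n <= k)%N -> derive1n n g 0 = 0) ->
  Ck_near k 0 (fun y => s y * g y) /\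
  forall n, (n <= k)%N -> derive1n n (fun y => s y * g y) 0 = 0.
Proof.
rewrite /Ck_near => /nbhs_ballP[e /= e0 Bg] g0.
set U := ball (0 : R) e; have oU : open U by exact: ball_open.
have E := step_derive1n oU (fun x Ux => (Bg x Ux).1) g0.
split; last by move=> n nk; rewrite E ?g0 ?mulr0//; exact: ballxx.
apply/nbhs_ballP; exists e => //= x Ux.
have nU : \forall y \near x, U y by exact: open_nbhs_nbhs (conj oU Ux).
have [dg cg] := Bg _ Ux; split.
- move=> n nk.
  apply: (@near_eq_derivable _ _ _ (fun y => s y * derive1n n g y)).
    by apply: filterS nU => y Uy; rewrite E// ltnW.
  have [] // := step_is_derive (dg _ nk) _.
  by move=> _; rewrite -derive1nS !g0// ltnW.
- rewrite /prop_for /continuous_at E//.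
  apply: (@cvg_trans _ (s y * derive1n k g y @[y --> x])).
    by apply: near_eq_cvg; apply: filterS nU => y Uy; rewrite E.
  have [x0|x0] := eqVneq x 0.
    by rewrite x0; apply: step_continuous0; [exact: g0|rewrite -x0].
  apply: (@cvg_trans _ (s x * derive1n k g y @[y --> x])).
    by apply: near_eq_cvg; near=> y; rewrite (near (s_loc x0) y).
  by have := cvgM (cvg_cst (s x)) cg; exact.
Unshelve. all: by end_near. Qed.

End StepMultiplier.

(** * Fourier-like wavelets *)

Lemma sg_near {R : realType} (x : R) : x != 0 ->
  \forall y \near x, Num.sg y = Num.sg x.
Proof.
move=> x0; have [xp|xn|x00] := ltgtP x 0; last by rewrite x00 eqxx in x0.
- near=> y; rewrite !ltr0_sg//; near: y; exact: lt_nbhsl.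
- near=> y; rewrite !gtr0_sg//; near: y; exact: lt_nbhsr.
Unshelve. all: by end_near. Qed.

Theorem proposition4 (R : realType) (N : nat) (psi Hpsi : R -> R[i]) :
  (1 <= N)%N ->
  is_wavelet psi ->
  vanishing_moments N psi ->
  is_hilbert psi Hpsi ->
  vanishing_moments N (fourier_like psi Hpsi).
Proof.
move=> N1 _ vm [F' [fF' hF']].
case: vm => F [G [fF FG CRe CIm G0]].
case: N N1 CRe CIm G0 => [|k _ /= CRe CIm G0]; first by rewrite ltn0.
pose c : R[i] := ((Num.sqrt 2)^-1)%:C.
pose s (w : R) : R := (Num.sqrt 2)^-1 * (1 - Num.sg w).
have s_loc x : x != 0 -> \forall y \near x, s y = s x.
  by move=> /sg_near; apply: filterS => y; rewrite /s => ->.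
have s_bnd x : `|s x| <= (Num.sqrt 2)^-1 * 2.
  rewrite normrM ger0_norm ?invr_ge0 ?sqrtr_ge0// ler_wpM2l ?invr_ge0 ?sqrtr_ge0//.
  by rewrite (le_trans (ler_normB _ _))// normr1 normr_sg; case: eqP => _ /=; lra.
(* F' is the spectrum coming from the Hilbert transform, while G is the smooth
   version of the spectrum; they agree almost everywhere. *)
exists (fun w => c * F' w + - (c * 'i%C) * (- 'i%C * (Num.sg w)%:C * F' w)).
exists (fun w => (s w)%:C * G w).
have ReG : (fun w => complex.Re ((s w)%:C * G w)) = fun w => s w * complex.Re (G w).
  by apply/funext => w; rewrite Re_mul /= mul0r subr0.
have ImG : (fun w => complex.Im ((s w)%:C * G w)) = fun w => s w * complex.Im (G w).
  by apply/funext => w; rewrite Im_mul /= mul0r addr0.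
have [ReS ReS0] := step_Ck_near_flat s_loc s_bnd CRe (fun n nk => (G0 n nk).1).
have [ImS ImS0] := step_Ck_near_flat s_loc s_bnd CIm (fun n nk => (G0 n nk).2).
split.
- rewrite (_ : fourier_like _ _ =
      fun t => c * psi t + - (c * 'i%C) * Hpsi t); first exact: is_fourier_lin.
  by apply/funext => t; rewrite /fourier_like mulrBr mulNr mulrA.
- move: FG (is_fourier_unique fF fF'); apply: (@filterS2 _ _
    (ae_filter_ringOfSetsType (@lebesgue_measure R))) => w FG FF'.
  rewrite -FF' FG /s rmorphM rmorphB rmorph1 -/c.
  have ii : 'i%C * 'i%C = -1 :> R[i] by rewrite -expr2 sqr_i.
  (* -j times -j sgn is -sgn, which gives the factor 1 - sgn of s *)
  transitivity (c * G w + c * ('i%C * 'i%C) * (Num.sg w)%:C * G w).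
    by ring.
  by rewrite ii; ring.
- by rewrite ReG.
- by rewrite ImG.
- by move=> n nk; rewrite ReG ImG; split; [exact: ReS0|exact: ImS0].
Qed.
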